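(* Let $M$ be a von Neumann algebra in standard form on $L^2(M)$, and let $\theta,\phi\in\mathrm{Aut}(M)$. Let $\mathcal E_\theta=(Mu_\theta,(\mathrm{id}_M,L^2(M)),(\mathrm{id}_M,L^2(M)))$ and $\mathcal E_\phi=(Mu_\phi,(\mathrm{id}_M,L^2(M)),(\mathrm{id}_M,L^2(M)))$ be the associated Hilbert von Neumann $M$-$M$ bimodules. Then $\mathcal E_\theta\cong\mathcal E_\phi$ (as Hilbert von Neumann $M$-$M$ bimodules) if and only if $\theta$ and $\phi$ are inner conjugate, i.e. there is a unitary $u\in M$ with $\phi(x)=u\,\theta(x)\,u^*$ for all $x\in M$.
   Context: All Hilbert spaces are complex and separable. $(M,L^2(M),J,P)$ is a standard form of $M$ in the sense of Haagerup ($J$ the modular conjugation, $P$ the self-dual cone), and $\theta\mapsto u_\theta$ is the canonical unitary implementation of $\mathrm{Aut}(M)$ on $L^2(M)$: $u_\theta$ is the unique unitary with $u_\theta xu_\theta^*=\theta(x)$ for $x\in M$, $u_\theta J=Ju_\theta$ and $u_\theta P=P$. $Mu_\theta=\{xu_\theta:x\in M\}\subset\mathcal L(L^2(M))$. $[S]$ denotes the closure in the weak operator topology of the linear span of a set $S$ of operators. A Hilbert von Neumann $A_1$-$A_2$ bimodule is a tuple $(E,(\pi_1,\mathcal H_1),(\pi_2,\mathcal H_2))$ where $E\subset\mathcal L(\mathcal H_2,\mathcal H_1)$ satisfies $E=[E]\supset EE^*E$, $\pi_2:A_2\to[E^*E]$ is a normal ($*$-)isomorphism onto $[E^*E]$,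 and $\pi_1:A_1\to[EE^*]$ is a normal ($*$-)homomorphism with $\pi_1(1)$ the identity of $[EE^*]$. Two such bimodules $(E^{(i)},(\pi_1^{(i)},\mathcal H_1^{(i)}),(\pi_2^{(i)},\mathcal H_2^{(i)}))$, $i=1,2$, are isomorphic if there are unitaries $w_j:\mathcal H_j^{(1)}\to\mathcal H_j^{(2)}$, $j=1,2$, with $w_j$ being $A_j$-linear (i.e. $w_j\pi_j^{(1)}(a)=\pi_j^{(2)}(a)w_j$ for $a\in A_j$) such that $E^{(2)}=w_1E^{(1)}w_2^*$. *)

(* Defs.v *)
From HB Require Import structures.
From mathcomp Require Import all_boot all_order all_algebra sesquilinear.
From mathcomp Require Import complex.
From mathcomp Require Import all_classical all_reals.
From mathcomp Require Import topology normedtype.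
From mathcomp Require Import ring lra.
Set Implicit Arguments.
Unset Strict Implicit.
Unset Printing Implicit Defensive.
Import Order.TTheory GRing.Theory Num.Theory.
Import numFieldNormedType.Exports.
Local Open Scope classical_set_scope.
Local Open Scope ring_scope.

(* The inner product is linear in its first argument. *)
Record hilbert (R : realType) := Hilbert {
  hilbert_sort :> completeNormedModType R[i];
  hdot : {dot hilbert_sort for Num.conj};
  hdot_norm : forall x : hilbert_sort, hdot x x = `|x| ^+ 2;
  hilbert_separable : exists D : set hilbert_sort, countable D /\ dense D
}.

Notation "''[' x , y ]" := (hdot _ x y)
  (at level 0, format "''[' x ,  y ]") : ring_scope.

Section BoundedOperators.
Variables (R : realType) (H K : hilbert R).

Definition bounded_op : {pred H -> K} :=
  fun f => `[< linear f /\ continuous f >].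

Record bop := Bop { bop_fun :> H -> K; _ : bop_fun \in bounded_op }.

HB.instance Definition _ := [isSub for bop_fun].
HB.instance Definition _ := [Choice of bop by <:].

Lemma bounded_op_submod : submod_closed bounded_op.
Proof.
split=> [|a f g]; rewrite !inE /=.
  split; last by move=> x; exact: cvg_cst.
  by move=> a x y; rewrite scaler0 addr0.
move=> -[lf cf] [lg cg]; split.
  move=> b x y; rewrite !fctE lf lg scalerDr !scalerDr !scalerA mulrC.
  by rewrite -!addrA; congr (_ + _); rewrite addrCA.
by move=> x; apply: continuousD; [apply: continuousZl_tmp; exact: cf|exact: cg].
Qed.

HB.instance Definition _ :=
  GRing.isSubmodClosed.Build _ _ bounded_op bounded_op_submod.
HB.instance Definition _ := [SubChoice_isSubLmodule of bop by <:].

End BoundedOperators.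

Section InnerProduct.
Variables (R : realType) (H : hilbert R).
Implicit Types (x y z : H) (a : R[i]).

Lemma hdotC x y : '[x, y] = ('[y, x])^*.
Proof. by rewrite (hermC (hdot H)) expr0 mul1r. Qed.

Lemma hdotDl x y z : '[x + y, z] = '[x, z] + '[y, z].
Proof. exact: linearDl. Qed.

Lemma hdotDr x y z : '[x, y + z] = '[x, y] + '[x, z].
Proof. exact: linearDr. Qed.

Lemma hdotZl a x y : '[a *: x, y] = a * '[x, y].
Proof. exact: linearZl_LR. Qed.

Lemma hdotZr a x y : '[x, a *: y] = a^* * '[x, y].
Proof. exact: linearZr_LR. Qed.

Lemma hdotBl x y z : '[x - y, z] = '[x, z] - '[y, z].
Proof. exact: linearBl. Qed.

Lemma hdotBr x y z : '[x, y - z] = '[x, y] - '[x, z].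
Proof. exact: linearBr. Qed.

Lemma hdot_proj x y : y != 0 ->
  let s := '[x, y] / '[y, y] in
  '[x - s *: y, x - s *: y] = '[x, x] - `|'[x, y]| ^+ 2 / '[y, y].
Proof.
move=> y0; have : '[y, y] != 0 by rewrite dnorm_eq0.
have yr : ('[y, y])^* = '[y, y] by rewrite -hdotC.
rewrite /= !hdotBl !hdotBr !hdotZl !hdotZr rmorphM /= fmorphV /= yr.
rewrite (hdotC y x) normCK.
move: ('[x, y]) ('[y, y]) => a b b0.
by field.
Qed.

Lemma hdot_le x y : `|'[x, y]| <= `|x| * `|y|.
Proof.
have [->|y0] := eqVneq y 0.
  by rewrite linear0r !normr0 mulr0.
rewrite -(@ler_pXn2r _ 2) ?nnegrE ?mulr_ge0 ?normr_ge0//.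
rewrite exprMn -!hdot_norm -ler_pdivrMr ?dnorm_gt0//.
by rewrite -subr_ge0 -hdot_proj// dnorm_ge0.
Qed.

Lemma hdot_ext x y : (forall z, '[z, x] = '[z, y]) -> x = y.
Proof.
move=> h; apply/eqP; rewrite -subr_eq0 -(dnorm_eq0 (hdot H)).
by rewrite hdotBr h subrr.
Qed.

Lemma hdot_extl x y : (forall z, '[x, z] = '[y, z]) -> x = y.
Proof. by move=> h; apply: hdot_ext => z; rewrite hdotC h -hdotC. Qed.

Lemma hdot_parallelogram x y :
  '[x + y, x + y] + '[x - y, x - y] = 2 * ('[x, x] + '[y, y]).
Proof. by rewrite !(hdotBl, hdotBr, hdotDl, hdotDr); ring. Qed.

End InnerProduct.

Section Riesz.
Variables (R : realType) (H : hilbert R).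

Let nr (x : H) : R := complex.Re `|x|.

Let nrE x : `|x| = ((nr x)%:C)%C.
Proof. by rewrite /nr RRe_real// normr_real. Qed.

Let nr_ge0 x : 0 <= nr x.
Proof. by rewrite -ler0c -nrE normr_ge0. Qed.

Let nr_parallelogram x y :
  nr (x + y) ^+ 2 + nr (x - y) ^+ 2 = 2 * (nr x ^+ 2 + nr y ^+ 2).
Proof.
have := hdot_parallelogram x y; rewrite !hdot_norm !nrE => h.
by apply: complexI; rewrite !(rmorphD, rmorphM, rmorphXn, rmorph_nat) /=.
Qed.

Let nr2 x : nr (2 *: x) = 2 * nr x.
Proof.
apply: complexI; rewrite -nrE normrZ nrE rmorphM /= ger0_norm ?ler0n//.
by rewrite rmorph_nat.
Qed.

Lemma riesz (f : H -> R[i]) :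
  (forall a x y, f (a *: x + y) = a * f x + f y) ->
  continuous (f : H -> R[i]^o) -> exists z, forall x, f x = '[x, z].
Proof.
move=> lf cf.
have f0 : f 0 = 0 by have := lf (-1) 0 0; rewrite scaler0 addr0 mulN1r addNr.
have fZ a x : f (a *: x) = a * f x by rewrite -[a *: x]addr0 lf f0 addr0.
have fD x y : f (x + y) = f x + f y by rewrite -[x]scale1r lf mul1r scale1r.
have fB x y : f (x - y) = f x - f y by rewrite fD -scaleN1r fZ mulN1r.
have [f_eq0|] := pselect (forall x, f x = 0).
  by exists 0 => x; rewrite f_eq0 linear0r.
move=> /existsNP[x1 /eqP fx1].
pose A := [set x : H | f x = 1].
have A1 : A ((f x1)^-1 *: x1) by rewrite /A /= fZ mulVf.
pose d := inf (nr @` A).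
have hlb : has_lbound (nr @` A) by exists 0 => _ [x _ <-].
have d_le x : A x -> d <= nr x by move=> Ax; apply: ge_inf => //; exists x.
have hinf : has_inf (nr @` A) by split=> //; exists (nr ((f x1)^-1 *: x1)), ((f x1)^-1 *: x1).
have d0 : 0 <= d.
  by apply: lb_le_inf; [case: hinf | move=> _ [x _ <-]].
pose G (e : R) := A `&` [set x | nr x < d + e].
have G0 e : 0 < e -> exists x, G e x.
  move=> e0; have [_ [x Ax <-] xe] := inf_adherent e0 hinf.
  by exists x.
pose F := filter_from [set e : R | 0 < e] G.
have FF : ProperFilter F.
  apply: filter_from_proper; last by move=> e /G0.
  apply: filter_from_filter; first by exists 1 => /=.
  move=> e1 e2 /= e10 e20; exists (Num.min e1 e2); first by rewrite /= lt_min e10.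
  move=> x [Ax]; rewrite /= => h; split; split=> //=; apply: (lt_le_trans h);
  by rewrite lerD2l ge_min lexx ?orbT.
have cF : cauchy F.
  apply/cauchyP => eps eps0.
  have epsr : eps = (complex.Re eps)%:C%C by rewrite RRe_real// ger0_real// ltW.
  set r := complex.Re eps in epsr.
  have r0 : 0 < r by rewrite -ltcR -epsr.
  pose e := Num.min 1 (r ^+ 2 / (8 * d + 5)).
  have den : 0 < 8 * d + 5 by lra.
  have e0 : 0 < e by rewrite lt_min ltr01 divr_gt0// exprn_gt0.
  have [x Gx] := G0 e e0; exists x, e => // y Gy.
  rewrite -ball_normE /ball_/= nrE epsr ltcR.
  rewrite -(@ltr_pXn2r _ 2) ?nnegrE ?(ltW r0)//.
  have [Ax xe] := Gx; have [Ay ye] := Gy; rewrite /= in xe ye.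
  have m : d <= nr (2^-1 *: (x + y)).
    by apply: d_le; rewrite /A /= fZ fD Ax Ay -mulr2n mulVf// pnatr_eq0.
  have : nr (x + y) = 2 * nr (2^-1 *: (x + y)).
    by rewrite -nr2 scalerA divff ?scale1r// pnatr_eq0.
  have e1 : e <= 1 by rewrite ge_min lexx.
  have e2 : e * (8 * d + 5) <= r ^+ 2.
    by rewrite -ler_pdivlMr// ge_min lexx orbT.
  have := nr_parallelogram x y.
  have := nr_ge0 x; have := nr_ge0 y.
  move: m; move: (nr x) (nr y) (nr (x - y)) (nr (x + y)) (nr (2^-1 *: (x + y))) xe ye => a b c s t.
  move=> ad bd dt b0 a0 par st; subst s.
  have a2 : a ^+ 2 <= (d + e) ^+ 2.
    by rewrite ler_pXn2r// ?nnegrE ?addr_ge0 ?(ltW e0)// ltW.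
  have b2 : b ^+ 2 <= (d + e) ^+ 2.
    by rewrite ler_pXn2r// ?nnegrE ?addr_ge0 ?(ltW e0)// ltW.
  have t2 : d ^+ 2 <= t ^+ 2 by rewrite ler_pXn2r// nnegrE (le_trans d0).
  have ed : 0 <= e * d by rewrite mulr_ge0// ltW.
  have ee : e * e <= e by rewrite ger_pMr.
  nra.
have /cvg_ex[x0 /= Fx0] : cvg F by exact: cauchy_cvg.
have FA : F A by exists 1 => //= x [].
have Ax0 : A x0.
  apply: (@cvg_unique _ (@norm_hausdorff _ R[i]^o) (f @ F)).
    by apply: cvg_comp Fx0 _; exact: cf.
  have h : \forall x \near F, f x = 1 by exact: FA.
  apply: cvg_near_cst.
  by apply: filterS h => x ->.
have x0d : nr x0 = d.
  apply/eqP; rewrite eq_le d_le// andbT; apply/ler_addgt0Pr => e e0.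
  have : F (ball x0 (e / 2)%:C%C) by apply/Fx0/nbhsx_ballx; rewrite ltcR divr_gt0.
  have : F (G (e / 2)) by exists (e / 2) => //=; rewrite divr_gt0.
  move=> F1 F2; have [y [[_ /= y1] y2]] := filter_ex (filterI F1 F2).
  move: y2; rewrite -ball_normE /ball_/= nrE ltcR => y2.
  have : nr x0 <= nr (x0 - y) + nr y.
    by rewrite -lecR rmorphD /= -!nrE -{1}[x0](subrK y) ler_normD.
  lra.
have orth h : f h = 0 -> '[x0, h] = 0.
  move=> fh; have [->|h0] := eqVneq h 0; first by rewrite linear0r.
  have := hdot_proj x0 h0 => /=; set s := _ / _.
  have : d <= nr (x0 - s *: h) by apply: d_le; rewrite /A /= fB fZ fh mulr0 subr0.
  rewrite -x0d -(@ler_pXn2r _ 2) ?nnegrE// -lecR !rmorphXn /= -!nrE -!hdot_norm.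
  move=> le1 eq1; rewrite eq1 in le1.
  move: le1; rewrite -subr_ge0 addrAC subrr add0r oppr_ge0 => le1.
  have hh : 0 < ('[h, h])^-1 by rewrite invr_gt0 dnorm_gt0.
  apply/eqP; rewrite -normr_le0 -(@ler_pXn2r _ 2) ?nnegrE// expr0n /=.
  by rewrite -(pmulr_lle0 _ hh).
have x00 : x0 != 0.
  by apply: contraTneq isT => x00; move: Ax0; rewrite /A /= x00 f0 => /esym/eqP; rewrite oner_eq0.
have n0 : '[x0, x0] != 0 by rewrite dnorm_eq0.
exists (('[x0, x0])^-1 *: x0) => x.
have /orth : f (x - f x *: x0) = 0 by rewrite fB fZ Ax0 mulr1 subrr.
rewrite hdotBr hdotZr => /eqP; rewrite subr_eq0 => /eqP h.
rewrite hdotZr fmorphV /= -hdotC (hdotC x) h rmorphM /= conjCK -hdotC.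
by rewrite mulrCA mulVf ?mulr1.
Qed.

End Riesz.

Section OperatorTheory.
Variable R : realType.

Section Basic.
Variables H K : hilbert R.
Implicit Types S T : bop H K.

Lemma bop_ext S T : S =1 T -> S = T.
Proof. by move=> h; apply/val_inj/funext. Qed.

Lemma bopP T : linear T /\ continuous T.
Proof. by case: T => f /=; rewrite inE. Qed.

HB.instance Definition _ T := GRing.isLinear.Build _ _ _ _ T (bopP T).1.

Lemma bop_continuous T : continuous T. Proof. exact: (bopP T).2. Qed.

Definition mk_bop (f : H -> K) (lf : linear f) (cf : continuous f) : bop H K :=
  Bop (asboolT (conj lf cf)).

Lemma bopDE S T x : (S + T) x = S x + T x. Proof. by []. Qed.
Lemma bopZE a T x : (a *: T) x = a *: T x. Proof. by []. Qed.

End Basic.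

Definition op_id (H : hilbert R) : bop H H :=
  @mk_bop H H id (fun _ _ _ => erefl) (fun _ => @cvg_id _ _).

Section Comp.
Variables H K L : hilbert R.
Variables (S : bop K L) (T : bop H K).

Lemma op_comp_linear : linear (S \o T).
Proof. by move=> a x y /=; rewrite !linearP. Qed.

Lemma op_comp_continuous : continuous (S \o T).
Proof.
by move=> x; apply: continuous_comp; apply: bop_continuous.
Qed.

Definition op_comp : bop H L := mk_bop op_comp_linear op_comp_continuous.

End Comp.

Section Adjoint.
Variables H K : hilbert R.

Lemma adj_vec (T : bop H K) (y : K) : exists z, forall x, '[T x, y] = '[x, z].
Proof.
apply: riesz => [a x x'|x]; first by rewrite linearP hdotDl hdotZl.
have /linear_bounded_continuous/linear_boundedP := @bop_continuous _ _ T.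
move=> /pinfty_ex_gt0[r r0 rT].
have [->|y0] := eqVneq y 0.
  by under eq_fun do rewrite linear0r; exact: cvg_cst.
apply/(@cvgrPdist_lt _ R[i]^o) => e e0; near=> x'.
rewrite -hdotBl -linearB (le_lt_trans (hdot_le _ _))//.
rewrite -ltr_pdivlMr ?normr_gt0// (le_lt_trans (rT _))//.
rewrite -ltr_pdivlMl//; near: x'; apply: cvgr_dist_lt => //.
by rewrite mulr_gt0 ?invr_gt0// divr_gt0 ?normr_gt0.
Unshelve. all: by end_near. Qed.

Lemma adj_exists (T : bop H K) :
  exists S : bop K H, forall x y, '[T x, y] = '[x, S y].
Proof.
have [f fP] := choice (adj_vec T).
have lf : linear f.
  move=> a y z; apply: hdot_ext => x.
  by rewrite hdotDr hdotZr -!fP hdotDr hdotZr.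
suff cf : continuous f by exists (mk_bop lf cf) => x y; exact: fP.
pose g : {linear K -> H} := HB.pack f (GRing.isLinear.Build _ _ _ _ f lf).
apply: (@bounded_linear_continuous _ _ _ g); apply/linear_boundedP.
have /linear_bounded_continuous/linear_boundedP := @bop_continuous _ _ T.
move=> /pinfty_ex_gt0[r r0 rT]; near=> s => y /=.
have [->|n0] := eqVneq (f y) 0.
  by rewrite normr0 mulr_ge0//; near: s; apply: nbhs_pinfty_ge.
rewrite -(@ler_pM2r _ `|f y|) ?normr_gt0// -expr2 -hdot_norm.
rewrite -[leLHS](ger0_norm (dnorm_ge0 _ _)) -fP.
rewrite (le_trans (hdot_le _ _))// mulrAC ler_wpM2r//.
rewrite (le_trans (rT _))// ler_wpM2r//.
by near: s; apply: nbhs_pinfty_ge; exact: gtr0_real.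
Unshelve. all: by end_near. Qed.

Definition adj (T : bop H K) : bop K H := projT1 (cid (adj_exists T)).

Lemma adjP (T : bop H K) x y : '[T x, y] = '[x, adj T y].
Proof. exact: (projT2 (cid (adj_exists T))). Qed.

End Adjoint.

End OperatorTheory.

Notation "S ** T" := (op_comp S T) (at level 40, left associativity).

Section AdjointTheory.
Variable R : realType.

Lemma adj_uniq (H K : hilbert R) (T : bop H K) (S : bop K H) :
  (forall x y, '[T x, y] = '[x, S y]) -> adj T = S.
Proof. by move=> h; apply: bop_ext => y; apply: hdot_ext => x; rewrite -adjP h. Qed.

Variables H K L : hilbert R.

Lemma adjK (T : bop H K) : adj (adj T) = T.
Proof. by apply: adj_uniq => x y; rewrite hdotC -adjP -hdotC. Qed.

Lemma adjM (S : bop K L) (T : bop H K) : adj (S ** T) = adj T ** adj S.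
Proof. by apply: adj_uniq => x y /=; rewrite !adjP. Qed.

Lemma op_compA (G : hilbert R) (S : bop K L) (T : bop H K) (U : bop G H) :
  S ** (T ** U) = S ** T ** U.
Proof. exact: bop_ext. Qed.

Lemma op_comp1l (T : bop H K) : op_id K ** T = T.
Proof. exact: bop_ext. Qed.

Lemma op_comp1r (T : bop H K) : T ** op_id H = T.
Proof. exact: bop_ext. Qed.

End AdjointTheory.

Section WeakOperatorTopology.
Variable R : realType.

Section Wot.
Variables H K : hilbert R.

Definition matrix_coeff (T : bop H K) : {ptws H * K -> R[i]^o} :=
  fun p => '[T p.1, p.2].

Definition wot : Type := initial_topology matrix_coeff.

HB.instance Definition _ := Topological.on wot.

Lemma matrix_coeff_continuous (x : H) (y : K) :
  continuous ((fun T => '[T x, y]) : wot -> R[i]^o).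
Proof.
move=> T.
have /(pointwise_cvgP _ (fmap_filter _ (nbhs_filter (T : wot)))) :=
  @initial_continuous _ _ matrix_coeff T.
by move=> /(_ (x, y)).
Qed.

Definition linear_subspace (S : set (bop H K)) : Prop :=
  S 0 /\ forall a x y, S x -> S y -> S (a *: x + y).

Definition wot_span (S : set (bop H K)) : set (bop H K) :=
  @closure wot (smallest linear_subspace S).

End Wot.

Lemma wot_continuous (H K H' K' : hilbert R) (f : bop H K -> bop H' K') :
  (forall x y, exists x' y', forall T, '[f T x, y] = '[T x', y']) ->
  continuous (f : wot H K -> wot H' K').
Proof.
move=> hf; apply: continuous_comp_initial => T.
apply/(@pointwise_cvgP _ _ _ _ (fmap_filter _ (nbhs_filter (T : wot H K)))).
move=> [x y]; have [x' [y' hxy]] := hf x y.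
suff : (fun S : wot H K => '[f S x, y] : R[i]^o) @ T --> ('[f T x, y] : R[i]^o).
  exact.
have -> : (fun S : wot H K => '[f S x, y] : R[i]^o) = fun S => '[S x', y'].
  exact/funext.
by rewrite hxy; exact: matrix_coeff_continuous.
Qed.

Lemma closure_preimage (X Y : topologicalType) (f : X -> Y) (A : set X)
    (B : set Y) : continuous f -> (forall x, A x -> B (f x)) ->
  forall x, closure A x -> closure B (f x).
Proof.
move=> cf AB x clx V Vfx.
have [z [Az Vz]] := clx _ (cf x _ Vfx).
by exists (f z); split=> //; exact: AB.
Qed.

Lemma wot_span_id (H K : hilbert R) (S : set (bop H K)) :
  linear_subspace S -> closed (S : set (wot H K)) -> wot_span S = S.
Proof. by move=> lS cS; rewrite /wot_span smallest_id//; exact/esym/(@closure_id (wot H K)). Qed.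

End WeakOperatorTopology.

Record vn_algebra (R : realType) := VNAlgebra {
  vn_space : hilbert R;
  vn_set :> set (bop vn_space vn_space);
  vn_subspace : linear_subspace vn_set;
  vn_id : vn_set (op_id vn_space);
  vn_comp : forall x y, vn_set x -> vn_set y -> vn_set (x ** y);
  vn_adj : forall x, vn_set x -> vn_set (adj x);
  vn_closed : closed (vn_set : set (wot vn_space vn_space))
}.

Arguments vn_set {R} _ _.

Definition commutant (R : realType) (H : hilbert R) (M : set (bop H H)) : set (bop H H) :=
  [set y | forall x, M x -> x ** y = y ** x].

Definition unitary (R : realType) (H K : hilbert R) (u : bop H K) : Prop :=
  adj u ** u = op_id H /\ u ** adj u = op_id K.

(* [pi] is a total function, but only its restriction to [A] matters. *)
Definition star_hom (R : realType) (H K : hilbert R) (A : set (bop H H))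
    (B : set (bop K K)) (pi : bop H H -> bop K K) : Prop :=
  [/\ forall x, A x -> B (pi x),
      forall a x y, A x -> A y -> pi (a *: x + y) = a *: pi x + pi y,
      forall x y, A x -> A y -> pi (x ** y) = pi x ** pi y &
      forall x, A x -> pi (adj x) = adj (pi x)].

Definition op_le (R : realType) (H : hilbert R) (S T : bop H H) : Prop :=
  forall x : H, 0 <= '[(T - S) x, x].

(* Least upper bound in the ordered set of self-adjoint elements of [A]. *)
Definition op_lub (R : realType) (H : hilbert R) (A D : set (bop H H)) (S : bop H H) : Prop :=
  let ub T := [/\ A T, adj T = T & forall x, D x -> op_le x T] in
  ub S /\ forall T, ub T -> op_le S T.

Definition op_directed (R : realType) (H : hilbert R) (D : set (bop H H)) : Prop :=
  D !=set0 /\ forall x y, D x -> D y -> exists z, [/\ D z, op_le x z & op_le y z].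

Definition normal_map (R : realType) (H K : hilbert R) (A : set (bop H H)) (B : set (bop K K))
    (pi : bop H H -> bop K K) : Prop :=
  forall (D : set (bop H H)) (S : bop H H),
    (forall x, D x -> A x /\ adj x = x) -> op_directed D ->
    op_lub A D S -> op_lub B (pi @` D) (pi S).

Local Notation op M := (bop (vn_space M) (vn_space M)).

Record vn_aut (R : realType) (M : vn_algebra R) := VNAut {
  aut_fun :> op M -> op M;
  aut_hom : star_hom M M aut_fun;
  aut_bij : set_bij M M aut_fun
}.

Definition left_algebra (R : realType) (H K : hilbert R) (E : set (bop K H)) : set (bop H H) :=
  wot_span [set x ** adj y | x in E & y in E].

Definition right_algebra (R : realType) (H K : hilbert R) (E : set (bop K H)) : set (bop K K) :=
  wot_span [set adj x ** y | x in E & y in E].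

Record hvn_bimodule (R : realType) (A1 A2 : vn_algebra R) := HVNBimodule {
  hb_H1 : hilbert R;
  hb_H2 : hilbert R;
  hb_E : set (bop hb_H2 hb_H1);
  hb_pi1 : op A1 -> bop hb_H1 hb_H1;
  hb_pi2 : op A2 -> bop hb_H2 hb_H2;
  hb_closed : hb_E = wot_span hb_E;
  hb_ternary : forall x y z, hb_E x -> hb_E y -> hb_E z ->
    hb_E (x ** adj y ** z);
  hb_pi1_hom : star_hom A1 (left_algebra hb_E) hb_pi1;
  hb_pi1_normal : normal_map A1 (left_algebra hb_E) hb_pi1;
  hb_pi1_unit : forall x, left_algebra hb_E x ->
    hb_pi1 (op_id _) ** x = x /\ x ** hb_pi1 (op_id _) = x;
  hb_pi2_hom : star_hom A2 (right_algebra hb_E) hb_pi2;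
  hb_pi2_bij : set_bij A2 (right_algebra hb_E) hb_pi2;
  hb_pi2_normal : normal_map A2 (right_algebra hb_E) hb_pi2
}.

Arguments hb_E {R A1 A2} _ _.

Definition hb_iso (R : realType) (A1 A2 : vn_algebra R) (E F : hvn_bimodule A1 A2) : Prop :=
  exists (w1 : bop (hb_H1 E) (hb_H1 F)) (w2 : bop (hb_H2 E) (hb_H2 F)),
    [/\ unitary w1, unitary w2,
        forall a, vn_set A1 a -> w1 ** hb_pi1 E a = hb_pi1 F a ** w1,
        forall a, vn_set A2 a -> w2 ** hb_pi2 E a = hb_pi2 F a ** w2 &
        hb_E F = [set w1 ** x ** adj w2 | x in hb_E E]].

(* Haagerup's axioms: a conjugation J and a self-dual cone P with JMJ = M',
   JzJ = z^* for z central, J = id on P, and xJxJ P included in P. *)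
Record standard_form (R : realType) := StandardForm {
  sf_alg :> vn_algebra R;
  sf_J : vn_space sf_alg -> vn_space sf_alg;
  sf_P : set (vn_space sf_alg);
  sf_J_antilinear : forall a x y, sf_J (a *: x + y) = a^* *: sf_J x + sf_J y;
  sf_J_isometry : forall x y, '[sf_J x, sf_J y] = '[y, x];
  sf_J_involutive : involutive sf_J;
  sf_P_selfdual : sf_P = [set y | forall x, sf_P x -> 0 <= '[x, y]];
  sf_commutant : forall y : op sf_alg,
    commutant sf_alg y <->
    exists2 x : op sf_alg,
      vn_set sf_alg x & forall v, y v = sf_J (x (sf_J v));
  sf_center : forall z : op sf_alg,
    vn_set sf_alg z -> commutant sf_alg z -> forall v, sf_J (z (sf_J v)) = adj z v;
  sf_J_P : forall v, sf_P v -> sf_J v = v;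
  sf_P_stable : forall x : op sf_alg,
    vn_set sf_alg x -> forall v, sf_P v -> sf_P (x (sf_J (x (sf_J v))))
}.

Arguments sf_P {R} _ _.
Arguments sf_J {R} _ _.

(* By Haagerup's theorem, every [theta] has exactly one such [u]. *)
Definition canonical_impl (R : realType) (M : standard_form R) (theta : vn_aut M)
    (u : op M) : Prop :=
  [/\ unitary u,
      forall x, vn_set M x -> u ** x ** adj u = theta x,
      forall v, u (sf_J M v) = sf_J M (u v) &
      u @` sf_P M = sf_P M].

Definition inner_conjugate (R : realType) (M : vn_algebra R) (theta phi : vn_aut M) : Prop :=
  exists u, [/\ vn_set M u, unitary u &
    forall x, vn_set M x -> phi x = u ** theta x ** adj u].

Section TwistedBimodule.
Variables (R : realType) (M : standard_form R) (theta : vn_aut M).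
Variable u : bop (vn_space M) (vn_space M).
Hypothesis hu : canonical_impl theta u.

(* The space M u_theta of E_theta. *)
Definition twist_set : set (bop (vn_space M) (vn_space M)) :=
  [set x ** u | x in vn_set M].

Let uu : adj u ** u = op_id _. Proof. by case: hu => -[]. Qed.
Let uu' : u ** adj u = op_id _. Proof. by case: hu => -[]. Qed.

Let Mcomp x y : vn_set M x -> vn_set M y -> vn_set M (x ** y).
Proof. exact: vn_comp. Qed.

Let Madj x : vn_set M x -> vn_set M (adj x).
Proof. exact: vn_adj. Qed.

Let conjE x : vn_set M x -> u ** x = theta x ** u.
Proof.
case: hu => _ h _ _ Mx; rewrite -(h x Mx).
by rewrite -!op_compA uu op_comp1r.
Qed.

Let conj_inv x : vn_set M x -> vn_set M (adj u ** x ** u).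
Proof.
move=> Mx; have [_ _ sj] := aut_bij theta.
have [y My <-] := sj x Mx.
by rewrite -op_compA -conjE// op_compA uu op_comp1l.
Qed.

Lemma twist_set_span : twist_set = wot_span twist_set.
Proof.
rewrite wot_span_id//.
  have [M0 Ml] := vn_subspace M; split; first by exists 0 => //; exact: bop_ext.
  move=> a _ _ [x Mx <-] [y My <-]; exists (a *: x + y); first exact: Ml.
  exact: bop_ext.
move=> T clT; exists (T ** adj u); last by rewrite -op_compA uu op_comp1r.
apply: (@vn_closed _ M).
apply: (@closure_preimage _ _
  ((fun S => S ** adj u) : wot (vn_space M) (vn_space M) -> wot _ _) twist_set) => //.
  by apply: wot_continuous => x y; exists (adj u x), y.
by move=> _ [x Mx <-]; rewrite -op_compA uu' op_comp1r.
Qed.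

Let M_span : wot_span M = M.
Proof. by apply: wot_span_id; [exact: vn_subspace|exact: vn_closed]. Qed.

Lemma twist_left_algebra : left_algebra twist_set = M.
Proof.
rewrite /left_algebra -[RHS]M_span; congr wot_span; apply/seteqP; split.
  move=> _ [_ [x Mx <-] [_ [y My <-] <-]].
  rewrite adjM op_compA -(op_compA x) uu' op_comp1r.
  exact/Mcomp/Madj.
move=> x Mx; exists (x ** u); first by exists x.
exists (op_id _ ** u); first by exists (op_id _) => //; exact: vn_id.
by rewrite op_comp1l -op_compA uu' op_comp1r.
Qed.

Lemma twist_right_algebra : right_algebra twist_set = M.
Proof.
rewrite /right_algebra -[RHS]M_span; congr wot_span; apply/seteqP; split.
  move=> _ [_ [x Mx <-] [_ [y My <-] <-]].
  rewrite adjM -!op_compA (op_compA (adj x)) op_compA.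
  exact/conj_inv/Mcomp/My/Madj.
move=> x Mx; exists (op_id _ ** u).
  by exists (op_id _) => //; exact: vn_id.
exists (theta x ** u); last by rewrite op_comp1l -conjE// op_compA uu op_comp1l.
by exists (theta x) => //; have [h _ _ _] := aut_hom theta; exact: h.
Qed.

Lemma twist_ternary x y z :
  twist_set x -> twist_set y -> twist_set z -> twist_set (x ** adj y ** z).
Proof.
move=> [{}x Mx <-] [{}y My <-] [{}z Mz <-]; exists (x ** adj y ** z).
  by apply: Mcomp => //; apply: Mcomp => //; exact: Madj.
rewrite adjM !op_compA; congr (_ ** _ ** _ ** _).
by rewrite -(op_compA x) uu' op_comp1r.
Qed.

Let id_hom : star_hom M M id.
Proof. by split. Qed.

Let id_normal : normal_map M M id.
Proof. by move=> D S _ _; rewrite image_id. Qed.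

Lemma twist_left_hom : star_hom M (left_algebra twist_set) id.
Proof. by rewrite twist_left_algebra. Qed.

Lemma twist_left_normal : normal_map M (left_algebra twist_set) id.
Proof. by rewrite twist_left_algebra. Qed.

Lemma twist_left_unit x : left_algebra twist_set x ->
  op_id _ ** x = x /\ x ** op_id _ = x.
Proof. by rewrite op_comp1l op_comp1r. Qed.

Lemma twist_right_hom : star_hom M (right_algebra twist_set) id.
Proof. by rewrite twist_right_algebra. Qed.

Lemma twist_right_bij : set_bij M (right_algebra twist_set) id.
Proof. by rewrite twist_right_algebra; split=> // x Mx; exists x. Qed.

Lemma twist_right_normal : normal_map M (right_algebra twist_set) id.
Proof. by rewrite twist_right_algebra. Qed.

Definition twist_bimodule : hvn_bimodule M M :=
  HVNBimodule twist_set_span twist_ternary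
    twist_left_hom twist_left_normal twist_left_unit
    twist_right_hom twist_right_bij twist_right_normal.

End TwistedBimodule.

(* Main.v *)
Require Import Defs.
From mathcomp Require Import all_boot all_classical reals.
Local Open Scope classical_set_scope.

(** For unitaries [u_theta] and [u_phi] implementing [theta] and [phi], a
    unitary [x] satisfies [phi = x theta x^*] on [M] exactly when
    [w := x^* u_phi u_theta^*] commutes with [M]: conjugating by
    [u_phi u_theta^*] turns [theta y] into [phi y], and conjugating by [x^*]
    turns [phi y] back into [theta y].

    An isomorphism of the twisted bimodules is a pair of unitaries [w1], [w2]
    of the commutant of [M] with [M u_phi = w1 (M u_theta) w2^*].  Writing
    [u_phi] as an element of the right-hand side yields an [x] in [M] with
    [u_phi = x w1 u_theta w2^*]; as [w1] and [w2] commute with [M], comparing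
    how both sides carry [y] across gives [phi y x = x theta y], and [x] is
    unitary as a product of unitaries ([inner_of_intertwining]).  Conversely,
    when [phi = u theta u^*], the unitary [w := u^* u_phi u_theta^*] is in the
    commutant ([twist_intertwiner_commutes]), and [w (M u_theta) =
    M w u_theta = M u^* u_phi = M u_phi], so [(w, 1)] is an isomorphism.

    In terms of the modular conjugation this [w] is [J u J], because
    uniqueness of the canonical implementation gives
    [u_phi = u (J u J) u_theta]. *)

Section Unitary.
Context {R : realType}.

Lemma adj_id (H : hilbert R) : adj (op_id H) = op_id H.
Proof. exact: adj_uniq. Qed.

Lemma unitary_id (H : hilbert R) : unitary (op_id H).
Proof. by rewrite /unitary adj_id op_comp1l. Qed.

Lemma unitary_adj {H K : hilbert R} {u : bop H K} : unitary u -> unitary (adj u).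
Proof. by case=> uu uu'; rewrite /unitary adjK. Qed.

Lemma unitary_comp {H K L : hilbert R} {u : bop K L} {v : bop H K} :
  unitary u -> unitary v -> unitary (u ** v).
Proof.
move=> [uu uu'] [vv vv']; rewrite /unitary adjM; split.
  by rewrite -op_compA (op_compA (adj u)) uu op_comp1l.
by rewrite -op_compA (op_compA v) vv' op_comp1l.
Qed.

Lemma unitaryKr {H K L : hilbert R} {u : bop H K} (x : bop K L) :
  unitary u -> x ** u ** adj u = x.
Proof. by case=> _ uu'; rewrite -op_compA uu' op_comp1r. Qed.

Lemma unitaryVKr {H K L : hilbert R} {u : bop H K} (x : bop H L) :
  unitary u -> x ** adj u ** u = x.
Proof. by case=> uu _; rewrite -op_compA uu op_comp1r. Qed.

Lemma unitaryKl {H K L : hilbert R} {u : bop H K} (x : bop L H) :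
  unitary u -> adj u ** (u ** x) = x.
Proof. by case=> uu _; rewrite op_compA uu op_comp1l. Qed.

Lemma unitaryVKl {H K L : hilbert R} {u : bop H K} (x : bop L K) :
  unitary u -> u ** (adj u ** x) = x.
Proof. by case=> _ uu'; rewrite op_compA uu' op_comp1l. Qed.

Lemma unitary_comp_inj {H K L : hilbert R} {u : bop H K} {x y : bop K L} :
  unitary u -> x ** u = y ** u -> x = y.
Proof. by move=> Uu xy; rewrite -(unitaryKr x Uu) xy unitaryKr. Qed.

Lemma unitary_intertwine_adj {H K : hilbert R} {u : bop H K} {a b} :
  unitary u -> u ** a = b ** u -> adj u ** b = a ** adj u.
Proof.
move=> Uu ua; apply: (unitary_comp_inj Uu).
by rewrite -op_compA -ua unitaryKl// unitaryVKr.
Qed.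

End Unitary.

Section Implementation.
Context {R : realType} {M : standard_form R}.
Implicit Types (theta phi : vn_aut M) (u w x y : bop (vn_space M) (vn_space M)).

Lemma canonical_impl_unitary {theta u} : canonical_impl theta u -> unitary u.
Proof. by case. Qed.

Lemma canonical_impl_intertwine {theta u} y :
  canonical_impl theta u -> vn_set M y -> u ** y = theta y ** u.
Proof. by case=> Uu impl _ _ My; rewrite -impl// unitaryVKr. Qed.

Lemma vn_aut_closed theta y : vn_set M y -> vn_set M (theta y).
Proof. by case: (aut_hom theta) => + _ _ _; apply. Qed.

Lemma vn_aut_surj theta y :
  vn_set M y -> exists2 z, vn_set M z & theta z = y.
Proof. by have [_ _ surj] := aut_bij theta; apply: surj. Qed.

(** Both sides of [u_phi = x w1 u_theta w2^*] implement [phi]: moving [y]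
    leftwards produces [phi y] on one side and, after crossing the
    unitaries of the commutant, [theta y] to the right of [x] on the other. *)
Lemma inner_of_intertwining {theta phi u_theta u_phi w1 w2 x} :
  canonical_impl theta u_theta -> canonical_impl phi u_phi ->
  unitary w1 -> unitary w2 -> commutant M w1 -> commutant M w2 ->
  vn_set M x -> u_phi = x ** (w1 ** u_theta ** adj w2) ->
  unitary x /\ forall y, vn_set M y -> phi y = x ** theta y ** adj x.
Proof.
move=> ht hp Uw1 Uw2 w1C w2C Mx upE.
set v := w1 ** u_theta ** adj w2 in upE *.
have Uv : unitary v.
  by do 2?apply: unitary_comp => //; [exact: canonical_impl_unitary ht|exact: unitary_adj].
have Ux : unitary x.
  rewrite -(unitaryKr x Uv) -upE; apply: unitary_comp (unitary_adj Uv).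
  exact: canonical_impl_unitary hp.
have vE y : vn_set M y -> v ** y = theta y ** v.
  move=> My; have w2y : adj w2 ** y = y ** adj w2.
    by apply: unitary_intertwine_adj => //; rewrite w2C.
  rewrite /v -op_compA w2y op_compA -(op_compA w1).
  rewrite (canonical_impl_intertwine _ ht My) op_compA -w1C; last exact: vn_aut_closed.
  by rewrite -!op_compA.
split=> // y My; apply: (unitary_comp_inj Ux); rewrite unitaryVKr//.
apply: (unitary_comp_inj Uv); rewrite -!op_compA -vE// -upE op_compA -upE.
exact/esym/canonical_impl_intertwine.
Qed.

(** Every element of [M] is of the form [theta y], and [u_phi u_theta^*] sends
    it to [phi y = u theta y u^*], a conjugation that [u^*] undoes. *)
Lemma twist_intertwiner_commutes {theta phi u_theta u_phi u} :
  canonical_impl theta u_theta -> canonical_impl phi u_phi -> unitary u ->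
  (forall y, vn_set M y -> phi y = u ** theta y ** adj u) ->
  commutant M (adj u ** u_phi ** adj u_theta).
Proof.
move=> ht hp Uu phiE _ /(vn_aut_surj theta)[y My <-]; symmetry.
have Ut := canonical_impl_unitary ht.
rewrite -op_compA.
rewrite (unitary_intertwine_adj Ut (canonical_impl_intertwine _ ht My)).
rewrite op_compA -(op_compA (adj u)) (canonical_impl_intertwine _ hp My) phiE//.
by rewrite -!op_compA unitaryKl.
Qed.

End Implementation.

(** Both actions on a twisted bimodule are the inclusion of [M], so that
    linearity of [w1] and [w2] is membership in the commutant. *)
Lemma twist_isoP {R : realType} {M : standard_form R} {theta phi : vn_aut M}
    {u_theta u_phi : bop (vn_space M) (vn_space M)}
    (h_theta : canonical_impl theta u_theta)
    (h_phi : canonical_impl phi u_phi) :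
  hb_iso (twist_bimodule h_theta) (twist_bimodule h_phi) <->
  exists w1 w2 : bop (vn_space M) (vn_space M),
    [/\ unitary w1, unitary w2, commutant M w1, commutant M w2 &
        twist_set u_phi = [set w1 ** x ** adj w2 | x in twist_set u_theta]].
Proof.
by split=> -[w1 [w2 [Uw1 Uw2 w1C w2C twistE]]]; exists w1, w2; split=> // a Ma;
  apply/esym; [exact: w1C|exact: w2C|exact: w1C|exact: w2C].
Qed.

Theorem proposition4p1 (R : realType) (M : standard_form R)
    (theta phi : vn_aut M)
    (u_theta u_phi : bop (vn_space M) (vn_space M))
    (h_theta : canonical_impl theta u_theta)
    (h_phi : canonical_impl phi u_phi) :
  hb_iso (twist_bimodule h_theta) (twist_bimodule h_phi) <->
  inner_conjugate theta phi.
Proof.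
have Ut := canonical_impl_unitary h_theta.
have Up := canonical_impl_unitary h_phi.
apply: (iff_trans (twist_isoP h_theta h_phi)).
split=> [[w1 [w2 [Uw1 Uw2 w1C w2C twistE]]]|[u [Mu Uu phiE]]].
  have : twist_set u_phi u_phi.
    by exists (op_id _); [exact: vn_id|rewrite op_comp1l].
  rewrite {1}twistE => -[_ [x Mx <-]] upE.
  have upE' : u_phi = x ** (w1 ** u_theta ** adj w2).
    by rewrite -{1}upE !op_compA (w1C _ Mx).
  have [Ux xE] := inner_of_intertwining h_theta h_phi Uw1 Uw2 w1C w2C Mx upE'.
  by exists x.
have wC := twist_intertwiner_commutes h_theta h_phi Uu phiE.
set w := adj u ** u_phi ** adj u_theta in wC.
have wut : w ** u_theta = adj u ** u_phi by rewrite unitaryVKr.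
exists w, (op_id _); split=> //.
- by do 2?apply: unitary_comp => //; exact: unitary_adj.
- exact: unitary_id.
- by move=> a _; rewrite op_comp1l op_comp1r.
apply/seteqP; split=> [_ [x Mx <-]|_ [_ [x Mx <-] <-]].
  (* The factor u absorbs the u^* contained in w. *)
  have Mxu : vn_set M (x ** u) by exact: vn_comp.
  exists (x ** u ** u_theta); first by exists (x ** u).
  by rewrite adj_id op_comp1r op_compA -(wC _ Mxu) -op_compA wut -op_compA unitaryVKl.
exists (x ** adj u); first by apply: vn_comp => //; exact: vn_adj.
by rewrite adj_id op_comp1r op_compA -(wC _ Mx) -(op_compA x w) wut op_compA.
Qed.
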